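(* Let $\mathbf P=(P_1,\ldots,P_r)$ be a fine mixed cell in $\mathbb{R}^d$, with $d_i=\dim P_i$, and let $\mathbf v_{i,a}$ and $\kappa(\mathbf P)$ be as defined in the context. Then, as rational functions of $\mathbf x=(x_1,\dots,x_r)$ and $\mathbf z=(z_1,\dots,z_d)$, $$m_{\mathbf P}(\mathbf x,\mathbf z)=\kappa(\mathbf P)\,\frac{\prod_{i:d_i>0}x_i}{\prod_{i:d_i>0}\prod_{a=1}^{d_i+1}\bigl(h_{\mathbf x\mathbf P}(\mathbf v_{i,a})+\langle\mathbf v_{i,a},\mathbf z\rangle\bigr)},$$ where $h_{\mathbf x\mathbf P}(\mathbf v)=\sum_{i=1}^r x_i h_{P_i}(\mathbf v)$. In particular, when $\mathbf P$ is non-codegenerate, $$m_{\mathbf P}(\mathbf x)=\kappa(\mathbf P)\,\frac{\prod_{i:d_i>0}x_i}{\prod_{i:d_i>0}\prod_{a=1}^{d_i+1}h_{\mathbf x\mathbf P}(\mathbf v_{i,a})}.$$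
   Context: A fine mixed cell in $\mathbb{R}^d$ is a sequence $\mathbf P=(P_1,\dots,P_r)$ of simplices in $\mathbb{R}^d$ with $\sum_i\dim P_i=d$ and $\dim(P_1+\cdots+P_r)=d$. It is non-codegenerate if $\mathbf 0$ lies in the affine span of no facet of $P=P_1+\cdots+P_r$. For each $i$ with $d_i>0$ let $\mathbf p_{i,1},\dots,\mathbf p_{i,d_i+1}$ be the vertices of $P_i$. For $a\in\{1,\dots,d_i+1\}$, $\mathbf v_{i,a}\in\mathbb{R}^d$ is the unique vector that is orthogonal to the direction space of the affine span of $P_k$ for each $k\neq i$ and is the inner normal to the facet of $P_i$ opposite $\mathbf p_{i,a}$, scaled so that $\max_{\mathbf y\in P_i}\langle\mathbf y,\mathbf v_{i,a}\rangle-\min_{\mathbf y\in P_i}\langle\mathbf y,\mathbf v_{i,a}\rangle=1$; i.e. $\langle\mathbf p_{i,a}-\mathbf p_{i,b},\mathbf v_{i,a}\rangle=1$ for all $b\ne a$. Then $\sum_{a}\mathbf v_{i,a}=\mathbf 0$. Put $\kappa(\mathbf P)=|\det(\mathbf v_{i,j})_{i:\,d_i>0,\ 1\le j\le d_i}|$, the absolute determinant of these $d=\sum d_i$ vectors (independent of which $d_i$ of the $d_i+1$ vectors are used for each $i$). Support function: $h_{Q}(\mathbf v)=-\min_{\mathbf y\in Q}\langle\mathbf v,\mathbf y\rangle$. Dual mixed volume: with $P=P_1+\cdots+P_r$, normal fan $\mathcal N(P)$ (cones $\{\mathbf v:h_P(\mathbf v)=-\langle\mathbf v,\mathbf y\rangle\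 \forall\mathbf y\in F\}$ for faces $F$ of $P$), and any triangulation $\mathcal T$ of $\mathcal N(P)$ into full-dimensional simplicial cones generated by rays of $\mathcal N(P)$, $$m_{\mathbf P}(\mathbf x,\mathbf z)=\sum_{C=\mathrm{span}_{\ge0}(\mathbf w_1,\dots,\mathbf w_d)\in\mathcal T}\frac{|\det(\mathbf w_1,\dots,\mathbf w_d)|}{\prod_{j=1}^d\bigl(h_{\mathbf x\mathbf P}(\mathbf w_j)+\langle\mathbf w_j,\mathbf z\rangle\bigr)},$$ independent of $\mathcal T$ and the scaling of generators; $m_{\mathbf P}(\mathbf x)$ is the same expression with $\mathbf z=\mathbf 0$ (defined when no $h_{\mathbf x\mathbf P}(\mathbf w)$, $\mathbf w$ a ray of $\mathcal N(P)$, is identically zero in $\mathbf x$). *)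

(* Defs.v *)
From HB Require Import structures.
From mathcomp Require Import all_boot all_order all_algebra fraction.
From mathcomp Require Import mpoly.
From mathcomp Require Import boolp classical_sets reals.

Set Implicit Arguments.
Unset Strict Implicit.
Unset Printing Implicit Defensive.

Import Order.TTheory GRing.Theory Num.Theory.

Local Open Scope classical_set_scope.
Local Open Scope ring_scope.

Definition dot (R : realType) (d : nat) (u v : 'rV[R]_d) : R :=
  \sum_(k < d) u 0 k * v 0 k.

Definition affine_span (R : realType) (d : nat) (Q : set 'rV[R]_d) :
    set 'rV[R]_d :=
  [set y | exists (n : nat) (q : 'I_n -> 'rV[R]_d) (c : 'I_n -> R),
     [/\ forall a, Q (q a), \sum_(a < n) c a = 1 &
         y = \sum_(a < n) c a *: q a]].

Definition affinely_independent (R : realType) (d n : nat)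
    (q : 'I_n.+1 -> 'rV[R]_d) : Prop :=
  row_free (\matrix_(j < n) (q (lift ord0 j) - q ord0)).

(* [Q] has dimension [k] when it contains [k + 1] affinely independent points
   whose affine span contains [Q]. *)
Definition has_dim (R : realType) (d : nat) (Q : set 'rV[R]_d) (k : nat) :
    Prop :=
  exists q : 'I_k.+1 -> 'rV[R]_d,
    [/\ affinely_independent q, forall a, Q (q a) &
        Q `<=` affine_span (range q)].

Definition conv (R : realType) (d n : nat) (q : 'I_n -> 'rV[R]_d) :
    set 'rV[R]_d :=
  [set y | exists c : 'I_n -> R,
     [/\ forall a, 0 <= c a, \sum_(a < n) c a = 1 &
         y = \sum_(a < n) c a *: q a]].

Definition minkowski_sum (R : realType) (d r : nat)
    (Q : 'I_r -> set 'rV[R]_d) : set 'rV[R]_d :=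
  [set y | exists2 q : 'I_r -> 'rV[R]_d,
     (forall i, Q i (q i)) & y = \sum_(i < r) q i].

(* Faces of a polyhedron are nonempty; [Q] itself is a face ([u = 0]). *)
Definition is_face (R : realType) (d : nat) (Q F : set 'rV[R]_d) : Prop :=
  F !=set0 /\
  exists u : 'rV[R]_d,
    F = [set y | Q y /\ forall y', Q y' -> dot u y <= dot u y'].

Definition is_facet (R : realType) (d : nat) (Q F : set 'rV[R]_d) : Prop :=
  is_face Q F /\ exists k : nat, has_dim Q k.+1 /\ has_dim F k.

(* For a polytope [Q] the infimum is a minimum. *)
Definition support_fun (R : realType) (d : nat) (Q : set 'rV[R]_d)
    (v : 'rV[R]_d) : R :=
  - inf [set dot v y | y in Q].

Definition normal_cone (R : realType) (d : nat) (Q F : set 'rV[R]_d) :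
    set 'rV[R]_d :=
  [set v | forall y, F y -> support_fun Q v = - dot v y].

Definition normal_fan (R : realType) (d : nat) (Q : set 'rV[R]_d) :
    set (set 'rV[R]_d) :=
  [set normal_cone Q F | F in is_face Q].

Definition ray_generator (R : realType) (d : nat) (Q : set 'rV[R]_d)
    (w : 'rV[R]_d) : Prop :=
  w != 0 /\ normal_fan Q [set t *: w | t in [set t : R | 0 <= t]].

(* The cone generated by the rows of [W]. *)
Definition cone (R : realType) (d : nat) (W : 'M[R]_d) : set 'rV[R]_d :=
  [set c *m W | c in [set c : 'rV[R]_d | forall j, 0 <= c 0 j]].

(* Each maximal cone of a triangulation is given by a matrix whose rows are its
   generators. *)
Record is_triangulation (R : realType) (d : nat) (Q : set 'rV[R]_d) (N : nat)
    (W : 'I_N -> 'M[R]_d) : Prop := IsTriangulation {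
  tri_simplicial : forall k, \det (W k) != 0;
  tri_rays : forall k j, ray_generator Q (row j (W k));
  tri_refines : forall k, exists2 C, normal_fan Q C & cone (W k) `<=` C;
  tri_covers : \bigcup_(k in [set: 'I_N]) cone (W k) =
               \bigcup_(C in normal_fan Q) C;
  tri_faces : forall k l,
    is_face (cone (W k)) (cone (W k) `&` cone (W l));
  tri_distinct : injective (fun k => cone (W k))
}.

Record fine_mixed_cell (R : realType) (d r : nat) := FineMixedCell {
  cell_dim : 'I_r -> nat;
  vertex : forall i : 'I_r, 'I_(cell_dim i).+1 -> 'rV[R]_d;
  vertex_indep : forall i, affinely_independent (@vertex i);
  sum_cell_dim : (\sum_(i < r) cell_dim i)%N = d;
  dim_sum_cell : has_dim (minkowski_sum (fun i => conv (@vertex i))) d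
}.

Arguments cell_dim {R d r}.
Arguments vertex {R d r} _ _ _.

Section FineMixedCell.
Variables (R : realType) (d r : nat) (P : fine_mixed_cell R d r).

Definition cell (i : 'I_r) : set 'rV[R]_d := conv (vertex P i).

Definition cell_sum : set 'rV[R]_d := minkowski_sum cell.

Definition non_codegenerate : Prop :=
  forall F, is_facet cell_sum F -> ~ affine_span F 0.

(* The second condition says both that [v] is an inner normal to the facet of
   [cell i] opposite [vertex P i a] and that [cell i] has width [1] along [v]. *)
Definition is_facet_normal (i : 'I_r) (a : 'I_(cell_dim P i).+1)
    (v : 'rV[R]_d) : Prop :=
  (forall k, k != i -> forall y y',
     affine_span (cell k) y -> affine_span (cell k) y' ->
     dot (y - y') v = 0) /\
  (forall b, b != a -> dot (vertex P i a - vertex P i b) v = 1).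

(* The unique vector with this property; meaningful only if
   [0 < cell_dim P i]. *)
Definition facet_normal (i : 'I_r) (a : 'I_(cell_dim P i).+1) : 'rV[R]_d :=
  xget 0 [set v | is_facet_normal a v].

(* The rows are indexed by the pairs [(i, j)] with [j < cell_dim P i], so the
   points of [P] contribute none. *)
Definition kappa : R :=
  `|\det (castmx (sum_cell_dim P, erefl d)
      (\mxcol_(i < r) \matrix_(j < cell_dim P i)
         facet_normal (widen_ord (leqnSn (cell_dim P i)) j)))|.

(* The linear form h_{xP}(v) + <v, z>. *)
Definition cell_form (n : nat) (x : 'I_r -> {mpoly R[n]})
    (z : 'I_d -> {mpoly R[n]}) (v : 'rV[R]_d) : {mpoly R[n]} :=
  \sum_(i < r) support_fun (cell i) v *: x i + \sum_(k < d) v 0 k *: z k.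

Definition dual_mixed_volume (N : nat) (W : 'I_N -> 'M[R]_d) (n : nat)
    (x : 'I_r -> {mpoly R[n]}) (z : 'I_d -> {mpoly R[n]}) :
    {fraction {mpoly R[n]}} :=
  \sum_(k < N) tofrac (`|\det (W k)|)%:MP /
    \prod_(j < d) tofrac (cell_form x z (row j (W k))).

End FineMixedCell.

(* Main.v *)
(* Put h_i = h_{P_i} and s_{i,a}(v) = <p_{i,a}, v> + h_i(v) >= 0.  Since
   <p_{k,b} - p_{k,c}, v_{i,a}> is 1, -1 or 0, every v equals
   sum_{i,a} s_{i,a}(v) v_{i,a}, and two vectors lie in the same cones of the
   normal fan of P exactly when the same s_{i,a} vanish on them.  So the rays
   are the v_{i,a} with d_i > 0, and the maximal cones, obtained by choosing
   one vertex b_i in every P_i and taking the v_{i,a} with a <> b_i, are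
   already simplicial.  They are therefore the only triangulation, and each
   has determinant kappa(P) in absolute value.  With
   l_{i,a} = h_{xP}(v_{i,a}) + <v_{i,a}, z> the sum factors as
   kappa(P) * prod_i (sum_b prod_{a <> b} 1 / l_{i,a})
     = kappa(P) * prod_i (sum_b l_{i,b}) / prod_{i,a} l_{i,a},
   and sum_b l_{i,b} = x_i because sum_b v_{i,b} = 0 and
   sum_b h_k(v_{i,b}) is 1 if k = i and 0 otherwise. *)
Require Import Defs.
From mathcomp Require Import all_boot all_order all_algebra fraction.
From mathcomp Require Import mpoly.
From mathcomp Require Import boolp classical_sets reals.
From mathcomp Require Import lra.

Set Implicit Arguments.
Unset Strict Implicit.
Unset Printing Implicit Defensive.

Import Order.TTheory GRing.Theory Num.Theory.

Local Open Scope classical_set_scope.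
Local Open Scope ring_scope.

(** * Dot product, support functions and affine spans *)

Section Dot.
Variables (R : realType) (d : nat).
Implicit Types u v w : 'rV[R]_d.

Lemma dotC u v : dot u v = dot v u.
Proof. by apply: eq_bigr => k _; rewrite mulrC. Qed.

Lemma dotDl u v w : dot (u + v) w = dot u w + dot v w.
Proof. by rewrite -big_split; apply: eq_bigr => k _; rewrite mxE mulrDl. Qed.

Lemma dotZl a u w : dot (a *: u) w = a * dot u w.
Proof. by rewrite mulr_sumr; apply: eq_bigr => k _; rewrite mxE mulrA. Qed.

Lemma dotBl u v w : dot (u - v) w = dot u w - dot v w.
Proof. by rewrite -scaleN1r dotDl dotZl mulN1r. Qed.

Lemma dot0l w : dot 0 w = 0.
Proof. by rewrite -(scale0r 0) dotZl mul0r. Qed.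

Lemma dot_suml (I : Type) (s : seq I) (Q : pred I) (F : I -> 'rV[R]_d) w :
  dot (\sum_(i <- s | Q i) F i) w = \sum_(i <- s | Q i) dot (F i) w.
Proof.
by elim/big_rec2: _ => [|i x y _ <-]; rewrite ?dot0l ?dotDl.
Qed.

Lemma dotBr u v w : dot w (u - v) = dot w u - dot w v.
Proof. by rewrite !(dotC w) dotBl. Qed.

Lemma dotZr a u w : dot w (a *: u) = a * dot w u.
Proof. by rewrite !(dotC w) dotZl. Qed.

Lemma dot_sumr (I : Type) (s : seq I) (Q : pred I) (F : I -> 'rV[R]_d) w :
  dot w (\sum_(i <- s | Q i) F i) = \sum_(i <- s | Q i) dot w (F i).
Proof. by rewrite dotC dot_suml; apply: eq_bigr => i _; rewrite dotC. Qed.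

Lemma mulmx_trE m n (A : 'M[R]_(m, d)) (B : 'M[R]_(n, d)) i j :
  (A *m B^T) i j = dot (row i A) (row j B).
Proof. by rewrite mxE; apply: eq_bigr => k _; rewrite !mxE. Qed.

Lemma support_fun_min (Q : set 'rV[R]_d) v y :
  Q y -> (forall y', Q y' -> dot v y <= dot v y') ->
  support_fun Q v = - dot v y.
Proof.
move=> Qy miny; congr (- _); apply/eqP; rewrite eq_le; apply/andP; split.
- apply: ge_inf; last by exists y.
  by exists (dot v y) => _ [y' Qy' <-]; apply: miny.
- apply: lb_le_inf; first by exists (dot v y), y.
  by move=> _ [y' Qy' <-]; apply: miny.
Qed.

Lemma conv_vertex n (q : 'I_n -> 'rV[R]_d) a : conv q (q a).
Proof.
exists (fun b => (b == a)%:R); split=> [b||]; first exact: ler0n.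
- by rewrite (bigD1 a) //= eqxx big1 ?addr0 // => b /negPf ->.
- rewrite (bigD1 a) //= eqxx scale1r big1 ?addr0 // => b /negPf ->.
  by rewrite scale0r.
Qed.

Lemma affine_span_sub (Q : set 'rV[R]_d) : Q `<=` affine_span Q.
Proof.
move=> y Qy; exists 1%N, (fun=> y), (fun=> 1); split=> //.
- by rewrite big_ord1.
- by rewrite big_ord1 scale1r.
Qed.

Lemma affine_spanS (Q Q' : set 'rV[R]_d) :
  Q `<=` Q' -> affine_span Q `<=` affine_span Q'.
Proof.
move=> sQQ' y [n [q [c [Qq c1 ->]]]]; exists n, q, c; split=> // a.
exact/sQQ'/Qq.
Qed.

Lemma dot_affine_span (Q : set 'rV[R]_d) v s :
  (forall y, Q y -> dot y v = s) -> forall y, affine_span Q y -> dot y v = s.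
Proof.
move=> Qs _ [n [q [c [Qq c1 ->]]]]; rewrite dot_suml.
under eq_bigr do rewrite dotZl Qs //.
by rewrite -mulr_suml c1 mul1r.
Qed.

End Dot.

Lemma big_codom (V : Type) (idx : V) (op : Monoid.com_law idx)
    (I J : finType) (f : I -> J) (Q : pred J) (F : J -> V) :
  injective f -> (forall j, reflect (exists i, j = f i) (Q j)) ->
  \big[op/idx]_(j | Q j) F j = \big[op/idx]_i F (f i).
Proof.
move=> finj QP; transitivity (\big[op/idx]_(j <- codom f) F j).
  rewrite big_uniq /=; last by rewrite map_inj_uniq ?enum_uniq.
  by apply: eq_bigl => j; apply/QP/codomP.
by rewrite big_map big_enum.
Qed.

Section FineMixedCell.
Variables (R : realType) (d r : nat) (P : fine_mixed_cell R d r).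

Local Notation K := {i : 'I_r & 'I_(cell_dim P i).+1}.
Local Notation mk := (Tagged (fun i : 'I_r => 'I_(cell_dim P i).+1)).
Implicit Types (b : 'I_r -> K) (k l : K) (u v w y : 'rV[R]_d).

(** * Vertices as pairs (i, a), and choices of one vertex per simplex *)

Definition pt k : 'rV[R]_d := vertex P (tag k) (tagged k).
Definition nv k : 'rV[R]_d := facet_normal (tagged k).

(** Values are pairs rather than elements of a dependent family, so that vertices of different
    simplices can be compared inside one finite type. *)
Definition selection (b : 'I_r -> K) : Prop := forall i, tag (b i) = i.

Definition selected_sum (b : 'I_r -> K) : 'rV[R]_d := \sum_(i < r) pt (b i).

Definition sel0 (i : 'I_r) : K := mk (ord0 : 'I_(cell_dim P i).+1).

Lemma sel0P : selection sel0. Proof. by []. Qed.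

Definition update (b : 'I_r -> K) k : 'I_r -> K :=
  fun i => if i == tag k then k else b i.

Lemma updateP b k : selection b -> selection (update b k).
Proof. by move=> bP i; rewrite /update; case: eqP. Qed.

Lemma update_tag b k : update b k (tag k) = k.
Proof. by rewrite /update eqxx. Qed.

(** * Edges of the simplices and the facet normals dual to them *)

Lemma dot_conv_vertex i v s :
  (forall a, dot (vertex P i a) v = s) ->
  forall y, conv (vertex P i) y -> dot y v = s.
Proof.
move=> Hs _ [c [c0 c1 ->]]; rewrite dot_suml.
under eq_bigr do rewrite dotZl Hs.
by rewrite -mulr_suml c1 mul1r.
Qed.

(** The edge directions of all simplices together span the space: a [v] orthogonal to them is
    constant on each simplex, hence on the Minkowski sum, which contains [d + 1] affinely
    independent points. *)
Lemma pt_sep v :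
  (forall k1 k2, tag k1 = tag k2 -> dot (pt k1 - pt k2) v = 0) -> v = 0.
Proof.
move=> H; have [q [qfree qP _]] := dim_sum_cell P.
have qs a : dot (q a) v = dot (selected_sum sel0) v.
  have [q' q'P ->] := qP a; rewrite !dot_suml; apply: eq_bigr => i _.
  apply: (dot_conv_vertex _ (q'P i)) => c.
  by apply/eqP; rewrite -subr_eq0 -dotBl (H (mk c) (sel0 i)).
move: qfree; rewrite /affinely_independent row_free_unit.
set M := \matrix_(j < d) _ => uM.
suff Mv : M *m v^T = 0.
  by apply: trmx_inj; rewrite -(mulKmx uM v^T) Mv mulmx0 trmx0.
apply/matrixP => i j; rewrite mulmx_trE rowK row_id mxE dotBl !qs.
by rewrite subrr.
Qed.

(* There are exactly [d] pairs [(i, a)] with [a <> b_i], so [e] enumerates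
   all of them. *)
Definition avoids (b : 'I_r -> K) (e : 'I_d -> K) : Prop :=
  injective e /\ forall j, e j != b (tag (e j)).

(** The number of pairs is the sum of all d_i + 1, that is d + r, and a selection, being injective,
    removes r of them. *)
Lemma card_avoiding b : selection b ->
  #|[pred k | k != b (tag k)]| = d.
Proof.
move=> bP; have binj : injective b by move=> i j /(congr1 tag); rewrite !bP.
have cardb : #|[pred k | k == b (tag k)]| = r.
  rewrite -[RHS]card_ord -(card_codom binj); apply: eq_card => k; rewrite !inE.
  apply/eqP/codomP => [->|[i ->]]; last by rewrite bP.
  by exists (tag k).
apply: (@addnI #|[pred k | k == b (tag k)]|); rewrite cardC cardb.
rewrite card_tagged sumnE big_map big_enum /=.
under eq_bigr do rewrite card_ord -addn1.
by rewrite big_split /= sum1_card card_ord sum_cell_dim addnC.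
Qed.

Lemma avoidsP b : selection b -> exists2 e : 'I_d -> K, avoids b e &
  forall k, k != b (tag k) -> exists j, k = e j.
Proof.
move=> bP; pose e j := enum_val (cast_ord (esym (card_avoiding bP)) j).
exists e; first split.
- by move=> j j' /enum_val_inj /cast_ord_inj.
- by move=> j; have := enum_valP (cast_ord (esym (card_avoiding bP)) j).
- move=> k kb; have kb' : k \in [pred k | k != b (tag k)] by [].
  exists (cast_ord (card_avoiding bP) (enum_rank_in kb' k)).
  by rewrite /e cast_ordK enum_rankK_in.
Qed.

Definition edges (b : 'I_r -> K) (e : 'I_d -> K) : 'M[R]_d :=
  \matrix_(j < d) (pt (e j) - pt (b (tag (e j)))).

Definition normals (e : 'I_d -> K) : 'M[R]_d := \matrix_(j < d) nv (e j).

(** The [d] edges starting at the vertices of [sel0] form a basis by [pt_sep], so products with them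
    can be prescribed freely; all other edges are combinations of these. *)
Lemma pt_dual (g : K -> R) :
  exists v, forall k1 k2, tag k1 = tag k2 ->
    dot (pt k1 - pt k2) v = g k1 - g k2.
Proof.
have [e [einj eb] eonto] := avoidsP sel0P.
pose A := edges sel0 e.
have pairE v (g' : K -> R) :
    (forall j, dot (row j A) v = g' (e j) - g' (sel0 (tag (e j)))) ->
    forall k1 k2, tag k1 = tag k2 -> dot (pt k1 - pt k2) v = g' k1 - g' k2.
  move=> H; have H0 k : dot (pt k) v - g' k
      = dot (pt (sel0 (tag k))) v - g' (sel0 (tag k)).
    have [<- //|/eonto[j ->]] := eqVneq k (sel0 (tag k)).
    by have := H j; rewrite rowK dotBl; lra.
  move=> k1 k2 k12; rewrite dotBl; have := H0 k1; rewrite k12 -H0; lra.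
have Au : A \in unitmx.
  rewrite -unitmx_tr -row_free_unit; apply: inj_row_free => v vA.
  apply: pt_sep => k1 k2 k12.
  rewrite (pairE v (fun=> 0) _ k1 k2 k12) /= ?subr0 // => j; rewrite dotC.
  by have := congr1 (fun M : 'rV_d => M 0 j) vA; rewrite mulmx_trE row_id mxE.
have AtU : A^T \in unitmx by rewrite unitmx_tr.
pose c : 'rV[R]_d := \row_j (g (e j) - g (sel0 (tag (e j)))).
exists (c *m (invmx A)^T); apply: pairE => j.
have := congr1 (fun M : 'rV_d => M 0 j) (mulmxKV AtU c).
rewrite -trmx_inv mulmx_trE row_id dotC => ->.
by rewrite mxE.
Qed.

(** Both clauses of [is_facet_normal] together say that [v] pairs with edges as the indicator of [k]
    does. [pt_dual] produces such a vector, so [xget] does not fall back on its default. *)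
Lemma nv_dual k k1 k2 : tag k1 = tag k2 ->
  dot (pt k1 - pt k2) (nv k) = (k1 == k)%:R - (k2 == k)%:R.
Proof.
have spec v : is_facet_normal (tagged k) v <-> forall k1 k2, tag k1 = tag k2 ->
    dot (pt k1 - pt k2) v = (k1 == k)%:R - (k2 == k)%:R.
  split=> [[H1 H2] [i a] [i' a'] /= ii'|H].
    case: i' / ii' a' => a'.
    (* On the other simplices [v] is constant; on the simplex of [k] it drops by 1 from that vertex
       to every other one. *)
    have [ik|ik] := eqVneq i (tag k); last first.
      rewrite (H1 i ik); last 2 first.
      - exact/affine_span_sub/conv_vertex.
      - exact/affine_span_sub/conv_vertex.
      have nek (c : 'I_(cell_dim P i).+1) : mk c == k = false.
        by apply: contraNF ik => /eqP <-.
      by rewrite !nek subrr.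
    case: k ik H1 H2 => j c /= ij; case: j / ij c => c _ H2.
    rewrite !eq_Tagged /= /pt /=.
    have H3 a0 : dot (vertex P i a0) v
        = dot (vertex P i c) v - (a0 != c)%:R.
      have [->|/H2] := eqVneq a0 c; first by rewrite subr0.
      by rewrite dotBl /=; lra.
    by rewrite dotBl (H3 a) (H3 a'); case: (a == c); case: (a' == c) => /=; lra.
  split=> [i ik y y' Sy Sy'|c ck]; last first.
    rewrite (H (mk (tagged k)) (mk c)) // -[k in (_ == k)]/k.
    case: k c ck {H} => j a c /= ca.
    by rewrite !eq_Tagged /= eqxx (negPf ca) subr0.
  have spani z : affine_span (cell P i) z -> dot z v = dot (pt (sel0 i)) v.
    apply: dot_affine_span; apply: dot_conv_vertex => c.
    apply/eqP; rewrite -subr_eq0 -dotBl (H (mk c) (sel0 i)) //.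
    have nek (a : 'I_(cell_dim P i).+1) : mk a == k = false.
      by apply: contraNF ik => /eqP <-.
    by rewrite !nek subrr.
  by rewrite dotBl !spani // subrr.
move: k1 k2; apply/spec; apply: xgetPex.
by have [v vP] := pt_dual (fun l => (l == k)%:R); exists v; apply/spec.
Qed.

Lemma big_fiber_tag (V : Type) (idx : V) (op : Monoid.com_law idx) i
    (F : K -> V) :
  \big[op/idx]_(k | tag k == i) F k =
  \big[op/idx]_(a < (cell_dim P i).+1) F (mk a).
Proof.
transitivity (\big[op/idx]_(k : K | (tag k == i) && true) F (mk (tagged k))).
  by apply: eq_big => [k|[j a]] //=; rewrite andbT.
rewrite -(sig_big_dep (pred1 i) (fun _ _ => true) (fun j a => F (mk a))).
by rewrite big_pred1_eq.
Qed.

Lemma cell_dim0_eq k l : tag k = tag l -> cell_dim P (tag k) = 0%N -> k = l.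
Proof.
case: k l => [i a] [j c] /= ij; case: j / ij c => c d0.
congr Tagged; apply: val_inj; case: a c => [m +] [n +] /=.
by rewrite d0 !ltnS !leqn0 => /eqP -> /eqP ->.
Qed.

Lemma sum_tag (V : nmodType) (F : K -> V) :
  \sum_k F k = \sum_i \sum_(a < (cell_dim P i).+1) F (mk a).
Proof.
rewrite (sig_big_dep xpredT (fun _ _ => true) (fun j a => F (mk a))).
by apply: eq_big => [k|[j a]].
Qed.

Lemma sum_delta (Q : pred K) k :
  \sum_(l | Q l) (k == l)%:R = (Q k)%:R :> R.
Proof.
rewrite big_mkcond (bigD1 k) //= eqxx big1 ?addr0; first by case: (Q k).
by move=> l; rewrite eq_sym => /negPf ->; rewrite if_same.
Qed.

(** Along an edge of simplex [i] the normals at its two ends contribute 1 and -1 and the others 0;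
    along edges of other simplices all contribute 0. Hence [pt_sep] applies. *)
Lemma sum_nv i : \sum_(k : K | tag k == i) nv k = 0.
Proof.
apply: pt_sep => k1 k2 k12; rewrite dot_sumr.
under eq_bigr do rewrite nv_dual //.
by rewrite sumrB !(sum_delta (fun k => tag k == i)) k12 subrr.
Qed.

(** * Slacks of a vector at the vertices *)

Lemma support_fun_cell v k :
  (forall l, tag l = tag k -> dot (pt k) v <= dot (pt l) v) ->
  support_fun (cell P (tag k)) v = - dot (pt k) v.
Proof.
move=> kmin; rewrite dotC; apply: support_fun_min; first exact: conv_vertex.
move=> _ [c [c0 c1 ->]]; rewrite dot_sumr -[leLHS]mul1r -c1 mulr_suml.
apply: ler_sum => a _; rewrite dotZr ler_wpM2l // !(dotC v).
exact: (kmin (mk a)).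
Qed.

(** The number s_{i,a}(v): since [support_fun] is minus a minimum, it is the excess of the value at
    vertex [k] over the minimum on its simplex. *)
Definition slack k v : R := dot (pt k) v + support_fun (cell P (tag k)) v.

Lemma slackB k1 k2 v : tag k1 = tag k2 ->
  slack k1 v - slack k2 v = dot (pt k1 - pt k2) v.
Proof. by move=> k12; rewrite /slack k12 dotBl; lra. Qed.

Lemma slack_min v i : exists k, [/\ tag k = i, slack k v = 0 &
  forall l, tag l = i -> 0 <= slack l v].
Proof.
have [a _ amin] := arg_minP (fun a => dot (pt (mk a)) v)
  (erefl : xpredT (ord0 : 'I_(cell_dim P i).+1)).
have kmin l : tag l = i -> dot (pt (mk a)) v <= dot (pt l) v.
  by case: l => j c /= /esym ij; case: j / ij c => c; apply: amin.
exists (mk a); rewrite /slack (@support_fun_cell v (mk a)) // addrN.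
split=> // l li; rewrite li (@support_fun_cell v (mk a)) // subr_ge0.
exact: kmin.
Qed.

Lemma slack_ge0 k v : 0 <= slack k v.
Proof. by have [_ [_ _]] := slack_min v (tag k); apply. Qed.

Lemma slack_selection v :
  exists2 b : 'I_r -> K, selection b & forall i, slack (b i) v = 0.
Proof.
have [b bP] := choice (slack_min v).
by exists b => i; case: (bP i).
Qed.

(** Products with edges determine the slacks up to one constant per simplex. Two nonnegative
    functions that each vanish somewhere on the simplex can only differ by the constant 0. *)
Lemma slack_char (g : K -> R) (b : 'I_r -> K) v :
  (forall k, 0 <= g k) -> selection b -> (forall i, g (b i) = 0) ->
  (forall k1 k2, tag k1 = tag k2 -> dot (pt k1 - pt k2) v = g k1 - g k2) ->
  forall k, slack k v = g k.
Proof.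
move=> g0 bP gb gv k; have [b' b'P b'v] := slack_selection v.
have k' : tag k = tag (b' (tag k)) by rewrite b'P.
have kb : tag (b (tag k)) = tag (b' (tag k)) by rewrite b'P bP.
have := slackB v k'; have := slackB v kb; rewrite !gv // gb b'v.
by have := slack_ge0 (b (tag k)) v; have := g0 (b' (tag k)); lra.
Qed.

(** Both sides have the same product with every edge, by [slackB] and [nv_dual], so [pt_sep]
    identifies them. *)
Lemma slack_expand v : v = \sum_k slack k v *: nv k.
Proof.
apply/eqP; rewrite -subr_eq0; apply/eqP.
apply: pt_sep => k1 k2 k12; rewrite dotBr -slackB // dot_sumr.
have sumE l : \sum_k slack k v * (l == k)%:R = slack l v.
  rewrite (bigD1 l) //= eqxx mulr1 big1 ?addr0 // => j.
  by rewrite eq_sym => /negPf ->; rewrite mulr0.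
under [X in _ - X]eq_bigr do rewrite dotZr nv_dual // mulrBr.
by rewrite sumrB !sumE subrr.
Qed.

Lemma selection_neq l : (0 < cell_dim P (tag l))%N ->
  exists2 b : 'I_r -> K, selection b & forall i, b i != l.
Proof.
case: l => i a /= di.
(* A vertex other than [a]; [ord_max] differs from [ord0] because the dimension is positive. *)
pose c : 'I_(cell_dim P i).+1 := if a == ord0 then ord_max else ord0.
exists (update sel0 (mk c)); first exact/updateP/sel0P.
move=> j; rewrite /update /=; case: (j =P i) => [_|ji]; last first.
  by apply/eqP => /(congr1 tag).
rewrite eq_Tagged /= /c; case: (eqVneq a ord0) => [->|]; last by rewrite eq_sym.
by rewrite -val_eqE /= -lt0n.
Qed.

Lemma slack_nv k l : (0 < cell_dim P (tag l))%N ->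
  slack k (nv l) = (k == l)%:R.
Proof.
move=> /selection_neq[b bP bl]; move: k.
apply: (@slack_char (fun k => (k == l)%:R) b) => //.
- by move=> i; rewrite (negPf (bl i)).
- by move=> k1 k2 /nv_dual.
Qed.

Lemma slack_neq0_dim k v : slack k v != 0 -> (0 < cell_dim P (tag k))%N.
Proof.
rewrite lt0n; apply: contraNneq => d0.
have [b bP bv] := slack_selection v.
by rewrite (@cell_dim0_eq k (b (tag k))) ?bP // bv.
Qed.

Lemma slackZ t k v : 0 <= t -> slack k (t *: v) = t * slack k v.
Proof.
move=> t0; have [b bP bv] := slack_selection v; move: k.
apply: (@slack_char (fun k => t * slack k v) b) => //.
- by move=> k; rewrite mulr_ge0 // slack_ge0.
- by move=> i; rewrite bv mulr0.
- by move=> k1 k2 k12; rewrite dotZr -slackB // mulrBr.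
Qed.

Lemma nv_neq0 k : (0 < cell_dim P (tag k))%N -> nv k != 0.
Proof.
move=> dk; apply/eqP => k0; have := slack_nv k dk.
rewrite k0 -(scale0r 0) slackZ // mul0r eqxx => /eqP.
by rewrite eq_sym oner_eq0.
Qed.

(** * Support function, faces and normal cones of the Minkowski sum *)

Definition support_sum v : R := \sum_(i < r) support_fun (cell P i) v.

(** The [c k] are barycentric coordinates of the summands of [y]. They add up to 1 on every simplex,
    which spreads each support value over the vertices, and they do not depend on [v]. *)
Lemma cell_sum_coord y : cell_sum P y ->
  exists2 c : K -> R, forall k, 0 <= c k &
    forall v, dot v y + support_sum v = \sum_k c k * slack k v.
Proof.
move=> [q /fin_all_exists[c cP] ->].
exists (fun k => c (tag k) (tagged k)) => [k|v]; first by case: (cP (tag k)).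
rewrite dot_sumr -big_split sum_tag; apply: eq_bigr => i _ /=.
have [c0 c1 ->] := cP i; under eq_bigr do rewrite /slack mulrDr.
rewrite big_split /= -mulr_suml c1 mul1r dot_sumr; congr (_ + _).
by apply: eq_bigr => a _; rewrite dotZr dotC.
Qed.

Lemma cell_sum_selected b : selection b -> cell_sum P (selected_sum b).
Proof.
move=> bP; exists (fun i => pt (b i)) => // i.
rewrite -{1}(bP i); exact: conv_vertex.
Qed.

Lemma dot_selected_sum b v : selection b ->
  dot v (selected_sum b) = \sum_i slack (b i) v - support_sum v.
Proof.
move=> bP; rewrite dot_sumr -sumrB; apply: eq_bigr => i _.
by rewrite /slack bP addrK dotC.
Qed.

Lemma support_sum_ge y v : cell_sum P y -> - support_sum v <= dot v y.
Proof.
move=> /cell_sum_coord[c c0 /(_ v) cE].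
rewrite -subr_ge0 opprK cE sumr_ge0 // => k _.
by rewrite mulr_ge0 // slack_ge0.
Qed.

Lemma dot_selected_sum0 b v : selection b -> (forall i, slack (b i) v = 0) ->
  dot v (selected_sum b) = - support_sum v.
Proof. by move=> bP bv; rewrite dot_selected_sum // big1 // sub0r. Qed.

Lemma support_fun_cell_sum v : support_fun (cell_sum P) v = support_sum v.
Proof.
have [b bP bv] := slack_selection v.
rewrite (@support_fun_min _ _ _ _ (selected_sum b)).
- by rewrite dot_selected_sum0 // opprK.
- exact: cell_sum_selected.
- by move=> y Py; rewrite dot_selected_sum0 // support_sum_ge.
Qed.

(** Convertible to the set in [is_face], so that the faces there can be folded into this name. *)
Definition min_face (Q : set 'rV[R]_d) u : set 'rV[R]_d :=
  [set y | Q y /\ forall y', Q y' -> dot u y <= dot u y'].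

Lemma min_faceE u y :
  min_face (cell_sum P) u y <-> cell_sum P y /\ dot u y = - support_sum u.
Proof.
split=> [[Py ymin]|[Py yu]]; split=> //; last first.
  by move=> y' Py'; rewrite yu support_sum_ge.
apply/eqP; rewrite eq_le support_sum_ge // andbT.
have [b bP bu] := slack_selection u.
by rewrite -(dot_selected_sum0 bP bu) ymin //; apply: cell_sum_selected.
Qed.

Lemma min_face_selected u b : selection b -> (forall i, slack (b i) u = 0) ->
  min_face (cell_sum P) u (selected_sum b).
Proof.
move=> bP bu; apply/min_faceE; split; first exact: cell_sum_selected.
exact: dot_selected_sum0.
Qed.

Lemma is_face_min_face u : is_face (cell_sum P) (min_face (cell_sum P) u).
Proof.
split; last by exists u.
have [b bP bu] := slack_selection u.
by exists (selected_sum b); apply: min_face_selected.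
Qed.

(** A point of the face has barycentric weight only at vertices whose slack at [u] is zero; if these
    slacks vanish at [w] too, the point also minimizes [w]. *)
Lemma normal_coneP u w :
  normal_cone (cell_sum P) (min_face (cell_sum P) u) w <->
  forall k, slack k u = 0 -> slack k w = 0.
Proof.
split=> [uw k ku|uw y /min_faceE[Py yu]]; last first.
  have [c c0 cE] := cell_sum_coord Py.
  suff : dot w y + support_sum w = 0 by rewrite support_fun_cell_sum; lra.
  rewrite cE big1 // => k _; have [/uw ->|ku] := eqVneq (slack k u) 0.
    by rewrite mulr0.
  suff -> : c k = 0 by rewrite mul0r.
  have /eqP : \sum_k c k * slack k u = 0 by rewrite -cE yu addNr.
  rewrite psumr_eq0 => [/allP/(_ k)|l _]; last by rewrite mulr_ge0 // slack_ge0.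
  by rewrite mem_index_enum mulf_eq0 (negPf ku) orbF => /(_ isT)/eqP.
have [b bP bu] := slack_selection u.
(* Conversely, redirecting a minimizing selection through [k] keeps its sum on the face. Its slacks
   at [w] are nonnegative with sum zero, so the one at [k] vanishes. *)
have b'P : selection (update b k) by exact: updateP.
have b'u i : slack (update b k i) u = 0.
  by rewrite /update; case: eqP.
have := uw _ (min_face_selected b'P b'u).
rewrite support_fun_cell_sum dot_selected_sum // => wE.
have /eqP : \sum_i slack (update b k i) w = 0 by lra.
rewrite psumr_eq0 => [/allP/(_ (tag k))|i _]; last exact: slack_ge0.
by rewrite mem_index_enum update_tag => /(_ isT)/eqP.
Qed.

(** * Rays of the normal fan *)

Lemma ray_generator_nv k : (0 < cell_dim P (tag k))%N ->
  ray_generator (cell_sum P) (nv k).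
Proof.
move=> dk; split; first exact: nv_neq0.
exists (min_face (cell_sum P) (nv k)); first exact: is_face_min_face.
apply/seteqP; split=> [w /normal_coneP kw|_ [t t0 <-]]; last first.
  by apply/normal_coneP => l; rewrite slackZ // => ->; rewrite mulr0.
exists (slack k w); first exact: slack_ge0.
(* At [nv k] only the slack of [k] is nonzero, so a [w] in the cone has a one-term expansion. *)
rewrite [RHS]slack_expand (bigD1 k) //= big1 ?addr0 // => l lk.
by rewrite kw ?scale0r // slack_nv // (negPf lk).
Qed.

(** A slack that is nonzero at [w] singles out a normal [nv k] in the same cone of the fan; that
    cone is the ray through [w], so the two are proportional. *)
Lemma ray_generatorP w : ray_generator (cell_sum P) w ->
  exists k t, [/\ (0 < cell_dim P (tag k))%N, 0 < t & w = t *: nv k].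
Proof.
case=> w0 [F [_ [u FE]] FC]; rewrite -/(min_face _ u) in FE.
have Cw : normal_cone (cell_sum P) F w.
  by rewrite FC; exists 1 => //=; rewrite scale1r.
have [k kw] : exists k, slack k w != 0.
  apply/existsP; apply: contraNT w0 => /existsPn kw.
  rewrite [w]slack_expand big1 // => k _.
  by have /negPn/eqP -> := kw k; rewrite scale0r.
have dk := slack_neq0_dim kw.
have : normal_cone (cell_sum P) F (nv k).
  rewrite FE; apply/normal_coneP => l lu; rewrite slack_nv //.
  case: eqP => // lk; move: Cw; rewrite FE => /normal_coneP/(_ _ lu).
  by rewrite lk => /eqP; rewrite (negPf kw).
rewrite FC => -[t t0 tw]; exists k, t^-1.
have tn0 : t != 0.
  by apply: contra_eq_neq tw => ->; rewrite scale0r eq_sym nv_neq0.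
split=> //; first by rewrite invr_gt0 lt_neqAle eq_sym tn0.
by rewrite -tw scalerA mulVf // scale1r.
Qed.

(** * Bases of normals and their determinants *)

Lemma avoids_onto b e k : selection b -> avoids b e -> k != b (tag k) ->
  exists j, k = e j.
Proof.
move=> bP [einj eb] kb; apply/codomP.
have sub : codom e \subset [pred k | k != b (tag k)].
  by apply/fintype.subsetP => _ /codomP[j ->]; apply: eb.
have cards : #|codom e| = #|[pred k | k != b (tag k)]|.
  by rewrite card_codom // card_ord card_avoiding.
by rewrite (subset_cardP cards sub k).
Qed.

(** The base vertex of the edge is selected, hence is none of the [e l]; only the first indicator of
    [nv_dual] remains. This makes edges and normals dual bases. *)
Lemma edge_dual b e (j l : 'I_d) : selection b -> avoids b e ->
  dot (pt (e j) - pt (b (tag (e j)))) (nv (e l)) = (j == l)%:R.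
Proof.
move=> bP [einj eb]; rewrite nv_dual ?bP // (inj_eq einj).
suff /negPf -> : b (tag (e j)) != e l by rewrite subr0.
by apply: contraNneq (eb l) => ble; rewrite -ble bP.
Qed.

Lemma edges_normals b e : selection b -> avoids b e ->
  edges b e *m (normals e)^T = 1%:M.
Proof.
move=> bP be; apply/matrixP => j l.
by rewrite mulmx_trE !rowK edge_dual // mxE.
Qed.

Lemma normals_edges b e : selection b -> avoids b e ->
  (edges b e)^T *m normals e = 1%:M.
Proof.
move=> bP be; apply: trmx_inj; rewrite trmx_mul trmxK trmx1.
exact/mulmx1C/edges_normals.
Qed.

Lemma normals_expand b e v : selection b -> avoids b e ->
  v = \sum_j dot (pt (e j) - pt (b (tag (e j)))) v *: nv (e j).
Proof.
move=> bP be; rewrite -[LHS]mulmx1 -(normals_edges bP be) mulmxA mulmx_sum_row.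
by apply: eq_bigr => j _; rewrite mulmx_trE row_id !rowK dotC.
Qed.

Lemma normals_sep b e v : selection b -> avoids b e ->
  (forall j, dot v (nv (e j)) = 0) -> v = 0.
Proof.
move=> bP be ve; rewrite -[LHS]mulmx1 -trmx1 -(normals_edges bP be) trmx_mul.
rewrite trmxK mulmxA; suff -> : v *m (normals e)^T = 0 by rewrite mul0mx.
by apply/rowP => j; rewrite mulmx_trE row_id rowK ve mxE.
Qed.

Lemma det_edges_normals b e : selection b -> avoids b e ->
  \det (edges b e) * \det (normals e) = 1.
Proof.
by move=> bP be; rewrite -(det_tr (normals e)) -det_mulmx edges_normals ?det1.
Qed.

Lemma det_normals_neq0 b e : selection b -> avoids b e ->
  \det (normals e) != 0.
Proof.
move=> bP be; have := oner_neq0 R; rewrite -(det_edges_normals bP be).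
by rewrite mulf_eq0 => /norP[].
Qed.

(* [edges b e *m (normals e')^T] has entries in {-1, 0, 1}, so its determinant
   is an integer; it is a unit, with inverse the determinant of
   [edges b' e' *m (normals e)^T]. *)
Lemma norm_det_normals b e b' e' :
  selection b -> avoids b e -> selection b' -> avoids b' e' ->
  `|\det (normals e)| = `|\det (normals e')|.
Proof.
have ge1 (c : 'I_r -> K) f (c' : 'I_r -> K) f' :
    selection c -> avoids c f -> selection c' -> avoids c' f' ->
    1 <= `|\det (edges c f)| * `|\det (normals f')|.
  move=> cP cf c'P cf'; rewrite -normrM -(det_tr (normals f')) -det_mulmx.
  apply: norm_intr_ge1.
    apply: rpred_sum => s _; apply: rpredM; first by rewrite rpredX // rpredN1.
    apply: rpred_prod => j _; rewrite mulmx_trE !rowK nv_dual ?cP //.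
    by rewrite rpredB // rpred_nat.
  rewrite det_mulmx det_tr.
  have := oner_neq0 R; rewrite -(det_edges_normals cP cf) mulf_eq0.
  by move=> /norP[Ac _]; rewrite mulf_neq0 // (det_normals_neq0 c'P cf').
move=> bP be b'P be'.
have := congr1 Num.norm (det_edges_normals bP be).
have := congr1 Num.norm (det_edges_normals b'P be').
have := ge1 _ _ _ _ bP be b'P be'; have := ge1 _ _ _ _ b'P be' bP be.
rewrite !normrM normr1.
move: `|\det (edges b e)| `|\det (normals e)| `|\det (edges b' e')|
  `|\det (normals e')| (normr_ge0 (\det (normals e)))
  (normr_ge0 (\det (normals e'))) => A V A' V' V0 V'0 A'V AV' A'V' AV.
apply/eqP; rewrite eq_le; apply/andP; split.
  by have := ler_wpM2l V0 AV'; rewrite mulr1 mulrA (mulrC V) AV mul1r.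
by have := ler_wpM2l V'0 A'V; rewrite mulr1 mulrA (mulrC V') A'V' mul1r.
Qed.

(** [kappa] omits the last normal of every simplex, so it belongs to the selection of last vertices;
    [norm_det_normals] carries it to any other selection. *)
Lemma kappaE b e : selection b -> avoids b e -> kappa P = `|\det (normals e)|.
Proof.
move=> bP be.
pose s (j : 'I_d) := tagnat.sig (cast_ord (esym (sum_cell_dim P)) j).
pose b0 i := mk (ord_max : 'I_(cell_dim P i).+1).
pose e0 j := mk (widen_ord (leqnSn (cell_dim P (tag (s j)))) (tagged (s j))).
have b0P : selection b0 by [].
have be0 : avoids b0 e0.
  split=> [j l|j]; last first.
    by rewrite eq_Tagged /= -val_eqE /= neq_ltn ltn_ord.
  move=> ejl; apply: (@cast_ord_inj _ _ (esym (sum_cell_dim P))).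
  apply: tagnat.sig_inj; rewrite -!/(s _).
  move: ejl; rewrite /e0; case: (s j) (s l) => i a [i' a'] /= ejl.
  have ii' : i = i' := congr1 tag ejl.
  case: i' / ii' a' ejl => a' /eqP; rewrite eq_Tagged /= => /eqP.
  by move=> /(congr1 val) /= aa'; congr Tagged; apply: val_inj.
rewrite (norm_det_normals bP be b0P be0); congr (`|\det _|).
by apply/matrixP => j l; rewrite castmxE !mxE /= cast_ord_id.
Qed.

(** * Maximal cones of the normal fan *)

Lemma slack_comb n b (f : 'I_n -> K) (c : 'I_n -> R) k : selection b ->
  (forall i j, b i != f j) -> (forall j, 0 <= c j) ->
  slack k (\sum_j c j *: nv (f j)) = \sum_j c j * (k == f j)%:R.
Proof.
move=> bP bf c0; move: k.
(* Slacks are not additive in general, but here the candidate slacks all vanish on the common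
   selection [b], as [slack_char] requires. *)
apply: (@slack_char (fun k => \sum_j c j * (k == f j)%:R) b) => //.
- by move=> k; apply: sumr_ge0 => j _; rewrite mulr_ge0.
- by move=> i; rewrite big1 // => j _; rewrite (negPf (bf i j)) mulr0.
- move=> k1 k2 k12; rewrite dot_sumr -sumrB; apply: eq_bigr => j _.
  by rewrite dotZr nv_dual // mulrBr.
Qed.

Lemma avoids_neq b e i j : selection b -> avoids b e -> b i != e j.
Proof.
by move=> bP [_ eb]; apply: contraNneq (eb j) => be; rewrite -be bP.
Qed.

(** The sum of the generators serves as an interior point of the cone: its slacks off the selection
    are nonzero, so it lies in no other selected cone. *)
Lemma slack_sum_normals b e k : selection b -> avoids b e ->
  slack k (\sum_j nv (e j)) = (k != b (tag k))%:R.
Proof.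
move=> bP be; under eq_bigr do rewrite -[nv _]scale1r.
rewrite (@slack_comb _ b) // => [|i j]; last exact: avoids_neq.
have [kb|/(avoids_onto bP be)[j ->]] := eqVneq k (b (tag k)).
  rewrite big1 // => j _.
  by rewrite kb (negPf (avoids_neq _ j bP be)) mulr0.
rewrite (bigD1 j) //= eqxx mul1r big1 ?addr0 // => l lj.
by rewrite (inj_eq (proj1 be)) eq_sym (negPf lj) mulr0.
Qed.

(** The normal cone of the vertex [selected_sum b] when [b] is a selection. *)
Definition selected_cone (b : 'I_r -> K) : set 'rV[R]_d :=
  [set v | forall i, slack (b i) v = 0].

Lemma coneE b e (t : 'I_d -> R) (W : 'M[R]_d) : selection b -> avoids b e ->
  (forall j, 0 < t j) -> (forall j, row j W = t j *: nv (e j)) ->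
  cone W = selected_cone b.
Proof.
move=> bP be t0 We; apply/seteqP; split=> [_ [c c0 <-] i|v bv].
  rewrite mulmx_sum_row; under eq_bigr do rewrite We scalerA.
  rewrite (@slack_comb _ b) // => [|i' j|j]; last 2 first.
  - exact: avoids_neq.
  - by rewrite mulr_ge0 // ltW.
  by rewrite big1 // => j _; rewrite (negPf (avoids_neq i j bP be)) mulr0.
(* On this cone the coefficients of [normals_expand] are slacks, since the base vertices have slack
   zero; dividing by [t j] undoes the scaling of the rows. *)
exists (\row_j (slack (e j) v / t j)).
  by move=> j /=; rewrite mxE divr_ge0 ?slack_ge0 // ltW.
rewrite mulmx_sum_row [RHS](normals_expand v bP be); apply: eq_bigr => j _.
by rewrite mxE We scalerA divfK ?gt_eqF // -slackB ?bP // bv subr0.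
Qed.

(** If the selections differ at [i], the normal at [b' i] lies in the first cone but not in the
    second. *)
Lemma selected_cone_inj b b' : selection b -> selection b' ->
  selected_cone b `<=` selected_cone b' -> b =1 b'.
Proof.
move=> bP b'P sub i; apply/eqP/negP => /negP bb'.
have db : (0 < cell_dim P (tag (b' i)))%N.
  move: bb'; rewrite lt0n; apply: contraNneq => d0.
  by apply/eqP/esym/cell_dim0_eq; rewrite ?bP ?b'P // -{1}(b'P i).
have : selected_cone b (nv (b' i)).
  move=> l; rewrite slack_nv //; case: eqP => // bl.
  move: bb'; rewrite -bl; have : tag (b l) = tag (b' i) by rewrite bl.
  by rewrite bP b'P => ->; rewrite eqxx.
by move=> /sub/(_ i); rewrite slack_nv // eqxx => /eqP; rewrite oner_eq0.
Qed.

(** * Facets of the sum and non-codegeneracy *)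

Lemma selected_sum_update b k : selection b ->
  selected_sum (update b k) - selected_sum b = pt k - pt (b (tag k)).
Proof.
move=> bP; rewrite -sumrB (bigD1 (tag k)) //= update_tag big1 ?addr0 // => i.
by rewrite /update => /negPf ->; rewrite subrr.
Qed.

(** Take a selection that misses [k]. It and its modifications at the [d - 1] other unselected
    vertices give [d] affinely independent points of the face, which span the whole hyperplane
    containing it. *)
Lemma is_facet_min_face k : (0 < cell_dim P (tag k))%N ->
  is_facet (cell_sum P) (min_face (cell_sum P) (nv k)) /\
  forall y, dot y (nv k) = - support_sum (nv k) ->
    affine_span (min_face (cell_sum P) (nv k)) y.
Proof.
move=> dk; have [b bP bk] := selection_neq dk.
have [e be _] := avoidsP bP; have [einj _] := be.
have [j0 kj0] : exists j0, k = e j0.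
  by apply: (avoids_onto bP be); rewrite eq_sym bk.
(* The index [j0] below [d] shows that [d] is positive. *)
have dm : d.-1.+1 = d by rewrite prednK // (leq_trans _ (ltn_ord j0)).
pose m := d.-1; pose h : 'I_m.+1 -> 'I_d := cast_ord dm.
(* Enumerates the positions in [e] other than that of [k]. *)
pose f (j : 'I_m) := h (lift (cast_ord (esym dm) j0) j).
have finj : injective f by move=> j l /cast_ord_inj /lift_inj.
have fj0 j : f j != j0.
  apply/eqP => /(congr1 (cast_ord (esym dm))); rewrite cast_ordK.
  by move=> /esym/eqP; rewrite (negPf (neq_lift _ _)).
have fP (l : 'I_d) : l != j0 -> exists j, l = f j.
  move=> lj0.
  have [j lj|lj] := unliftP (cast_ord (esym dm) j0) (cast_ord (esym dm) l).
    by exists j; rewrite /f /h -lj cast_ordKV.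
  by move/cast_ord_inj: lj lj0 => ->; rewrite eqxx.
pose q a := if unlift ord0 a is Some j then selected_sum (update b (e (f j)))
            else selected_sum b.
have q0 : q ord0 = selected_sum b by rewrite /q unlift_none.
have qS j : q (lift ord0 j) = selected_sum (update b (e (f j))).
  by rewrite /q liftK.
have qE j (l : 'I_d) :
    dot (q (lift ord0 j) - q ord0) (nv (e l)) = (f j == l)%:R.
  by rewrite qS q0 selected_sum_update // edge_dual.
have bk0 i : slack (b i) (nv k) = 0 by rewrite slack_nv // (negPf (bk i)).
have Fq a : min_face (cell_sum P) (nv k) (q a).
  rewrite /q; case: unliftP => [j _|_]; last exact: min_face_selected.
  apply: min_face_selected => [|i]; first exact: updateP.
  rewrite /update; case: ifP => // _.
  by rewrite slack_nv // kj0 (inj_eq einj) (negPf (fj0 j)).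
have qspan y : dot y (nv k) = - support_sum (nv k) -> affine_span (range q) y.
  (* By duality, products with the normals are coordinates along the edges; the weight of [q ord0]
     is what makes the total 1. *)
  move=> yk; pose g j := dot (y - q ord0) (nv (e (f j))).
  pose c a := if unlift ord0 a is Some j then g j else 1 - \sum_j g j.
  have c0 : c ord0 = 1 - \sum_j g j by rewrite /c unlift_none.
  have cS j : c (lift ord0 j) = g j by rewrite /c liftK.
  exists m.+1, q, c; split=> [a||]; first by exists a.
    by rewrite big_ord_recl c0 (eq_bigr _ (fun j _ => cS j)) subrK.
  have -> : \sum_a c a *: q a =
      q ord0 + \sum_j g j *: (q (lift ord0 j) - q ord0).
    rewrite big_ord_recl c0 scalerBl scale1r -addrA; congr (_ + _).
    rewrite scaler_suml addrC -sumrB; apply: eq_bigr => j _.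
    by rewrite cS scalerBr.
  apply/eqP; rewrite -subr_eq0 opprD addrA; apply/eqP.
  apply: (normals_sep bP be) => l; rewrite dotBl dot_suml.
  under eq_bigr do rewrite dotZl qE.
  (* Against the normal of [k] itself, [y] and [q ord0] have the same height and the edges used
     contribute nothing. *)
  have [->|/fP[j ->]] := eqVneq l j0.
    rewrite big1 => [|j _]; last by rewrite (negPf (fj0 j)) mulr0.
    rewrite subr0 -kj0 dotBl yk q0 dotC dot_selected_sum // big1 //.
    by rewrite sub0r subrr.
  rewrite (bigD1 j) //= eqxx mulr1 big1 ?addr0 ?subrr // => j' jj'.
  by rewrite (inj_eq finj) (negPf jj') mulr0.
have rangeF : range q `<=` min_face (cell_sum P) (nv k) by move=> _ [a _ <-].
split; last by move=> y /qspan; apply: affine_spanS.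
split; first exact: is_face_min_face.
exists m; split; first by rewrite /m dm; apply: dim_sum_cell.
exists q; split=> // [|y /min_faceE[_ yk]]; last by apply: qspan; rewrite dotC.
apply: inj_row_free => x; rewrite mulmx_sum_row => x0; apply/rowP => j.
have := congr1 (fun z => dot z (nv (e (f j)))) x0.
rewrite dot_suml dot0l (bigD1 j) //= rowK dotZl qE eqxx mulr1 big1 => [|l lj].
  by rewrite addr0 mxE.
by rewrite rowK dotZl qE (inj_eq finj) (negPf lj) mulr0.
Qed.

(** If the value were zero, the hyperplane spanned by the facet with normal [nv k] would pass
    through the origin. *)
Lemma non_codegenerate_support_sum k : (0 < cell_dim P (tag k))%N ->
  non_codegenerate P -> support_sum (nv k) != 0.
Proof.
move=> dk nc; have [facet span] := is_facet_min_face dk.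
by apply/eqP => h0; apply: (nc _ facet); apply: span; rewrite dot0l h0 oppr0.
Qed.

(** * Triangulations of the normal fan: existence and uniqueness *)

Lemma triangulation_exists :
  exists (N : nat) (W : 'I_N -> 'M[R]_d), is_triangulation (cell_sum P) W.
Proof.
(* One maximal cone for each selection, with the unscaled normals as generators. *)
pose S := {f : {ffun 'I_r -> K} | [forall i, tag (f i) == i]}.
have SP (s : S) : selection (val s).
  by move=> i; apply/eqP; move: i; apply/forallP/(valP s).
have /choice[e eP] (s : S) : exists f : 'I_d -> K, avoids (val s) f.
  by have [f ? _] := avoidsP (SP s); exists f.
pose b (n : 'I_#|{: S}|) : 'I_r -> K := val (enum_val n).
pose W (n : 'I_#|{: S}|) := normals (e (enum_val n)).
have bP n : selection (b n) by exact: SP.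
have be n : avoids (b n) (e (enum_val n)) by exact: eP.
have rowW n j : row j (W n) = nv (e (enum_val n) j) by rewrite rowK.
have coneW n : cone (W n) = selected_cone (b n).
  apply: (@coneE _ (e (enum_val n)) (fun=> 1)) => // j.
  by rewrite rowW scale1r.
exists #|{: S}|, W; split.
- by move=> n; apply: det_normals_neq0 (bP n) (be n).
- move=> n j; rewrite rowW; apply: ray_generator_nv.
  rewrite lt0n; apply/eqP => d0.
  have /eqP[] := avoids_neq (tag (e (enum_val n) j)) j (bP n) (be n).
  by apply/esym/cell_dim0_eq; rewrite ?bP.
(* The normal cone of the face minimizing an interior point contains the whole cone. *)
- move=> n; pose u := \sum_j nv (e (enum_val n) j).
  exists (normal_cone (cell_sum P) (min_face (cell_sum P) u)).
    by exists (min_face (cell_sum P) u) => //; apply: is_face_min_face.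
  rewrite coneW => v bv; apply/normal_coneP => k.
  rewrite (slack_sum_normals _ (bP n) (be n)) => /eqP.
  by rewrite pnatr_eq0 eqb0 negbK => /eqP ->; apply: bv.
- apply/seteqP; split=> v _.
    exists (normal_cone (cell_sum P) (min_face (cell_sum P) v)).
      by exists (min_face (cell_sum P) v) => //; apply: is_face_min_face.
    exact/normal_coneP.
  have [c cP cv] := slack_selection v.
  have cT : [forall i, tag (finfun c i) == i].
    by apply/forallP => i; rewrite ffunE cP.
  exists (enum_rank (Sub (finfun c) cT : S)) => //; rewrite coneW => i.
  by rewrite /b enum_rankK /= ffunE.
- move=> n m; rewrite !coneW.
  have dotE y : selected_cone (b n) y ->
      dot (selected_sum (b m) - selected_sum (b n)) y = \sum_i slack (b m i) y.
    move=> ny; rewrite dotBl !(dotC _ y) !dot_selected_sum //.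
    by rewrite [X in _ - (X - _)]big1 // sub0r opprK subrK.
  have zeroC (c : 'I_r -> K) : selected_cone c 0.
    by move=> i; rewrite -(scale0r (nv (c i))) slackZ // mul0r.
  split; first by exists 0; split; apply: zeroC.
  (* On the cone of [b n] this functional is a sum of slacks, hence nonnegative, and it vanishes
     there exactly on the cone of [b m]. *)
  exists (selected_sum (b m) - selected_sum (b n)).
  apply/seteqP; split=> y [ny my]; split=> //.
    move=> y' ny'; rewrite !dotE // big1 // sumr_ge0 // => i _.
    exact: slack_ge0.
  have := my _ (zeroC (b n)); rewrite [leRHS]dotC dot0l dotE // => sum_le0.
  have /eqP : \sum_i slack (b m i) y = 0.
    by apply/eqP; rewrite eq_le sum_le0 sumr_ge0 // => i _; apply: slack_ge0.
  rewrite psumr_eq0 => [/allP s0 i|i _]; last exact: slack_ge0.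
  by apply/eqP/s0; rewrite mem_index_enum.
- move=> n m /=; rewrite !coneW => nm; apply: enum_val_inj; apply: val_inj.
  by apply/ffunP; apply: (selected_cone_inj (bP n) (bP m)); rewrite nm.
Qed.

Lemma scaled_normalsE (e : 'I_d -> K) (t : 'I_d -> R) (W : 'M[R]_d) :
  (forall j, row j W = t j *: nv (e j)) ->
  W = diag_mx (\row_j t j) *m normals e.
Proof.
move=> We; apply/row_matrixP => j.
by rewrite We row_mul row_diag_mx -scalemxAl -rowE mxE rowK.
Qed.

(** The cone lies in a normal cone, hence in [selected_cone b] for a minimizing selection [b]. Its
    rays are then multiples of normals off [b], and the nonzero determinant makes them distinct. *)
Lemma triangulation_cone N (W : 'I_N -> 'M[R]_d) n :
  is_triangulation (cell_sum P) W -> exists b e t,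
  [/\ selection b, avoids b e, forall j, 0 < t j :> R &
      forall j, row j (W n) = t j *: nv (e j)].
Proof.
move=> triW.
have /choice[e /choice[t etP]] j := ray_generatorP (tri_rays triW n j).
have t0 j : 0 < t j by case: (etP j).
have We j : row j (W n) = t j *: nv (e j) by case: (etP j).
have [_ [F [_ [u FE]] <-] WC] := tri_refines triW n.
rewrite -/(min_face _ u) in FE.
have [b bP bu] := slack_selection u.
exists b, e, t; split=> //; split=> [j l ejl|j].
  apply/eqP; apply: contraTT isT => jl.
  have /eqP[] := tri_simplicial triW n.
  rewrite (scaled_normalsE We) det_mulmx.
  rewrite (determinant_alternate (A := normals e) jl) ?mulr0 // => i.
  by rewrite !mxE ejl.
have : cone (W n) (row j (W n)).
  exists (delta_mx 0 j); last by rewrite -rowE.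
  by move=> i /=; rewrite mxE ler0n.
move=> /WC; rewrite FE => /normal_coneP/(_ _ (bu (tag (e j)))).
have dj : (0 < cell_dim P (tag (e j)))%N by case: (etP j).
rewrite We slackZ ?(ltW (t0 j)) // slack_nv // => /eqP.
by rewrite mulf_eq0 gt_eqF //= pnatr_eq0 eqb0 eq_sym.
Qed.

(** The cone covering the interior point of [selected_cone b] is itself a selected cone, and that
    point lies in only one of those. *)
Lemma triangulation_onto N (W : 'I_N -> 'M[R]_d) b :
  is_triangulation (cell_sum P) W -> selection b ->
  exists n, cone (W n) = selected_cone b.
Proof.
move=> triW bP; have [e be _] := avoidsP bP.
pose u := \sum_j nv (e j).
have : (\bigcup_(n in [set: 'I_N]) cone (W n)) u.
  rewrite (tri_covers triW).
  exists (normal_cone (cell_sum P) (min_face (cell_sum P) u)).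
    by exists (min_face (cell_sum P) u) => //; apply: is_face_min_face.
  exact/normal_coneP.
move=> [n _ nu]; exists n.
have [c [f [t [cP cf t0 Wf]]]] := triangulation_cone n triW.
move: nu; rewrite (coneE cP cf t0 Wf) => nu.
suff -> : c = b by [].
apply/funext => i; have := nu i; rewrite (slack_sum_normals _ bP be).
move=> /eqP.
by rewrite pnatr_eq0 eqb0 negbK cP => /eqP.
Qed.

(** * Summation over the triangulation *)

Section CellForm.
Variables (n : nat) (x : 'I_r -> {mpoly R[n]}) (z : 'I_d -> {mpoly R[n]}).

Lemma support_funZ i t v : 0 <= t ->
  support_fun (cell P i) (t *: v) = t * support_fun (cell P i) v.
Proof.
move=> t0; have := slackZ (sel0 i) v t0.
by rewrite /slack /= dotZr mulrDr => /addrI.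
Qed.

Lemma cell_formZ t v : 0 <= t ->
  cell_form P x z (t *: v) = t *: cell_form P x z v.
Proof.
move=> t0; rewrite /cell_form scalerDr !scaler_sumr; congr (_ + _).
  by apply: eq_bigr => i _; rewrite support_funZ // scalerA.
by apply: eq_bigr => k _; rewrite mxE scalerA.
Qed.

(** Sum the slack of one vertex of simplex [j] over these normals: the products with the vertex
    cancel by [sum_nv], leaving the support values, while [slack_nv] evaluates each slack. *)
Lemma sum_support_fun_nv i j : (0 < cell_dim P i)%N ->
  \sum_(k : K | tag k == i) support_fun (cell P j) (nv k) = (j == i)%:R.
Proof.
move=> di; have := sum_delta (fun k : K => tag k == i) (sel0 j).
rewrite /= => <-.
have <- : dot (pt (sel0 j)) (\sum_(k : K | tag k == i) nv k) +
    \sum_(k : K | tag k == i) support_fun (cell P j) (nv k) =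
    \sum_(k : K | tag k == i) (sel0 j == k)%:R.
  rewrite dot_sumr -big_split; apply: eq_bigr => k /eqP ki /=.
  by rewrite -slack_nv ?ki.
by rewrite sum_nv dotC dot0l add0r.
Qed.

Lemma sum_cell_form_nv i : (0 < cell_dim P i)%N ->
  \sum_(k : K | tag k == i) cell_form P x z (nv k) = x i.
Proof.
move=> di; rewrite big_split /=.
rewrite [X in X + _]exchange_big [X in _ + X]exchange_big /=.
rewrite [X in _ + X]big1 => [|k _]; last first.
  rewrite -scaler_suml (_ : \sum_(_ | _) _ = 0) ?scale0r //.
  have := congr1 (fun v : 'rV_d => v 0 k) (sum_nv i).
  by rewrite summxE mxE.
rewrite addr0 (bigD1 i) //= -scaler_suml sum_support_fun_nv // eqxx scale1r.
rewrite big1 ?addr0 // => j /negPf ji.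
by rewrite -scaler_suml sum_support_fun_nv // ji scale0r.
Qed.

Let L k : {fraction {mpoly R[n]}} := tofrac (cell_form P x z (nv k)).

(** The scaling by [t] multiplies the determinant and the denominator by the same product; the
    remaining determinant is [kappa] in absolute value. *)
Lemma triangulation_term b e t (W : 'M[R]_d) : selection b -> avoids b e ->
  (forall j, 0 < t j) -> (forall j, row j W = t j *: nv (e j)) ->
  tofrac (`|\det W|)%:MP / \prod_(j < d) tofrac (cell_form P x z (row j W)) =
  tofrac (kappa P)%:MP * \prod_(k | k != b (tag k)) (L k)^-1.
Proof.
move=> bP be t0 We.
rewrite (scaled_normalsE We) det_mulmx det_diag normrM -(kappaE bP be).
rewrite ger0_norm; last first.
  by apply: prodr_ge0 => j _; rewrite mxE ltW.
rewrite (mulrC (\prod_i _)) mpolyCM tofracM -mulrA; congr (_ * _).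
rewrite -prodfV rmorph_prod rmorph_prod -big_split /=.
transitivity (\prod_j (L (e j))^-1).
  apply: eq_bigr => j _; rewrite mxE -(scaled_normalsE We) We.
  rewrite cell_formZ ?ltW // -mul_mpolyC tofracM invfM mulVKf //.
  by rewrite tofrac_eq0 mpolyC_eq0 gt_eqF.
symmetry; apply: big_codom (proj1 be) _ => k.
apply: (iffP idP) => [/(avoids_onto bP be)//|[j ->]]; exact: (proj2 be).
Qed.

Lemma cell_factor i :
  (forall k, (0 < cell_dim P (tag k))%N -> cell_form P x z (nv k) != 0) ->
  \sum_(m : K | tag m == i) \prod_(k | (tag k == i) && (k != m)) (L k)^-1 =
  if (0 < cell_dim P i)%N
  then tofrac (x i) / \prod_(k | tag k == i) L k else 1.
Proof.
(* A point contributes one empty product, equal to 1. Otherwise the common denominator leaves the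
   sum of the forms, which is [x i]. *)
move=> nz; case: ifP => [di|/negbT]; last first.
  rewrite -eqn0Ngt => /eqP d0.
  have i0 k : (tag k == i) = (k == sel0 i).
    apply/eqP/eqP => [ki|-> //]; apply: cell_dim0_eq => //.
    by rewrite ki.
  rewrite (big_pred1 (sel0 i)) // big1 // => k.
  by rewrite i0; case: eqP.
rewrite -(sum_cell_form_nv di) rmorph_sum mulr_suml; apply: eq_bigr => m mi.
rewrite (bigD1 m mi) /= invfM mulrA divff ?mul1r ?prodfV //.
by rewrite tofrac_eq0 nz // (eqP mi).
Qed.

Lemma dual_mixed_volumeE N (W : 'I_N -> 'M[R]_d) :
  is_triangulation (cell_sum P) W ->
  (forall k, (0 < cell_dim P (tag k))%N -> cell_form P x z (nv k) != 0) ->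
  dual_mixed_volume P W x z =
  tofrac (kappa P)%:MP *
  (\prod_(i < r | (0 < cell_dim P i)%N) tofrac (x i) /
   \prod_(i < r | (0 < cell_dim P i)%N) \prod_(a < (cell_dim P i).+1)
     tofrac (cell_form P x z (facet_normal a))).
Proof.
move=> triW nz.
have /choice[b bE] m : exists b : {ffun 'I_r -> K}, [/\ selection b,
    cone (W m) = selected_cone b &
    tofrac (`|\det (W m)|)%:MP /
      \prod_(j < d) tofrac (cell_form P x z (row j (W m))) =
    tofrac (kappa P)%:MP * \prod_(k | k != b (tag k)) (L k)^-1].
  have [b [e [t [bP be t0 We]]]] := triangulation_cone m triW.
  have bf : finfun b = b :> ('I_r -> K) by apply/funext => i; rewrite ffunE.
  exists (finfun b); rewrite bf; split=> //; first exact: coneE We.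
  exact: triangulation_term We.
have [bP bC bT] : [/\ forall m, selection (b m),
    forall m, cone (W m) = selected_cone (b m) & forall m, _] :=
  And3 (fun m => let: And3 h _ _ := bE m in h)
       (fun m => let: And3 _ h _ := bE m in h)
       (fun m => let: And3 _ _ h := bE m in h).
have binj : injective b.
  by move=> m m' bmm'; apply: (tri_distinct triW); rewrite /= !bC bmm'.
rewrite /dual_mixed_volume (eq_bigr _ (fun m _ => bT m)) -mulr_sumr.
congr (_ * _).
(* The cones of the triangulation correspond one to one to the selections, and each product is
   grouped by simplex. *)
transitivity (\sum_(f in family (fun i => [pred k : K | tag k == i]))
    \prod_i \prod_(k | (tag k == i) && (k != f i)) (L k)^-1).
  rewrite [RHS](eq_bigr (fun f : {ffun 'I_r -> K} =>
    \prod_(k | k != f (tag k)) (L k)^-1)) => [|f _].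
    symmetry; apply: big_codom binj _ => f.
    apply: (iffP familyP) => [fP|[m -> i]]; last first.
      by rewrite inE bP.
    have {}fP : selection f by move=> i; have := fP i; rewrite inE => /eqP.
    have [m mf] := triangulation_onto triW fP; exists m => //.
    apply/ffunP; apply: (selected_cone_inj fP (bP m)).
    by rewrite -mf bC.
  rewrite [RHS](partition_big tag xpredT) //=; apply: eq_bigr => i _.
  apply: eq_bigl => k; rewrite andbC.
  by case: (tag k =P i) => [->|]; rewrite ?andbF.
(* The choices in different simplices are independent, so the sum of products is a product of
   sums. *)
rewrite -(bigA_distr_big_dep _
  (fun i m => \prod_(k | (tag k == i) && (k != m)) (L k)^-1)).
rewrite -prodf_div [RHS]big_mkcond /=; apply: eq_bigr => i _.
by rewrite cell_factor // (big_fiber_tag _ i L).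
Qed.

End CellForm.

(** * Nonvanishing of the denominators *)

Lemma cell_form_generic_neq0 v : v != 0 ->
  cell_form P (fun i => 'X_(lshift d i) : {mpoly R[r + d]})
    (fun j => 'X_(rshift r j)) v != 0.
Proof.
(* At x = 0 and z = v the form takes the value <v, v>. *)
apply: contraNneq => /(congr1 (meval (fun i : 'I_(r + d) =>
  if split i is inr j then v 0 j else 0))).
rewrite meval0 mevalD !raddf_sum /= big1 => [|i _]; last first.
  by rewrite mevalZ mevalXU (unsplitK (inl i)) mulr0.
rewrite add0r => /eqP.
under eq_bigr => j _ do rewrite mevalZ mevalXU (unsplitK (inr j)).
rewrite psumr_eq0 => [/allP v0|j _]; last by rewrite -expr2 sqr_ge0.
apply/eqP/rowP => j; rewrite mxE; have := v0 j (mem_index_enum _).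
by rewrite mulf_eq0 orbb => /eqP.
Qed.

Lemma cell_form_x_neq0 v : support_sum v != 0 ->
  cell_form P (fun i : 'I_r => 'X_i : {mpoly R[r]})
    (fun _ : 'I_d => 0 : {mpoly R[r]}) v != 0.
Proof.
(* With every x_i equal to 1 the form takes the value [support_sum v]. *)
apply: contra_neq => /(congr1 (meval (fun=> 1))).
rewrite meval0 mevalD !raddf_sum /= [X in _ + X]big1 => [|k _]; last first.
  by rewrite scaler0 meval0.
by rewrite addr0 => <-; apply: eq_bigr => i _; rewrite mevalZ mevalXU mulr1.
Qed.

End FineMixedCell.

Theorem proposition8p4 (R : realType) (d r : nat) (P : fine_mixed_cell R d r) :
  (exists (N : nat) (W : 'I_N -> 'M[R]_d),
     is_triangulation (cell_sum P) W) /\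
  (forall (N : nat) (W : 'I_N -> 'M[R]_d),
     is_triangulation (cell_sum P) W ->
     (let x := fun i : 'I_r => 'X_(lshift d i) : {mpoly R[r + d]} in
      let z := fun k : 'I_d => 'X_(rshift r k) : {mpoly R[r + d]} in
      dual_mixed_volume P W x z =
      tofrac (kappa P)%:MP *
      (\prod_(i < r | (0 < cell_dim P i)%N) tofrac (x i) /
       \prod_(i < r | (0 < cell_dim P i)%N) \prod_(a < (cell_dim P i).+1)
         tofrac (cell_form P x z (facet_normal a)))) /\
     (non_codegenerate P ->
      let x := fun i : 'I_r => 'X_i : {mpoly R[r]} in
      let z := fun _ : 'I_d => 0 : {mpoly R[r]} in
      (forall w, ray_generator (cell_sum P) w -> cell_form P x z w != 0) /\
      dual_mixed_volume P W x z =
      tofrac (kappa P)%:MP *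
      (\prod_(i < r | (0 < cell_dim P i)%N) tofrac (x i) /
       \prod_(i < r | (0 < cell_dim P i)%N) \prod_(a < (cell_dim P i).+1)
         tofrac (cell_form P x z (facet_normal a))))).
Proof.
split=> [|N W triW]; first exact: triangulation_exists.
split=> [x z|nc x z].
  by apply: dual_mixed_volumeE => // k dk; apply/cell_form_generic_neq0/nv_neq0.
have nz (k : {i : 'I_r & 'I_(cell_dim P i).+1}) :
    (0 < cell_dim P (tag k))%N -> cell_form P x z (nv k) != 0.
  by move=> dk; apply/cell_form_x_neq0/non_codegenerate_support_sum.
split; last exact: dual_mixed_volumeE.
move=> w /ray_generatorP[k [t [dk t0 ->]]].
by rewrite cell_formZ ?ltW // scaler_eq0 negb_or gt_eqF //= nz.
Qed.
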